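(* Let $G$ be a graph of order $n$ without isolated vertices. Then $C_t^{oi}(G)\le n-\gamma_t^{oi}(G)+2$. Moreover, this bound is sharp, i.e. there exist graphs without isolated vertices for which equality holds.
   Context: All graphs are finite, simple and undirected, with vertex set $V(G)$; the order is $|V(G)|$. A set $D\subseteq V(G)$ is a total outer-independent dominating set (TOIDS) of $G$ if every vertex of $G$ is adjacent to at least one vertex of $D$ and $V(G)\setminus D$ is an independent set of $G$. The minimum cardinality of a TOIDS of $G$ is denoted $\gamma_t^{oi}(G)$. Two nonempty disjoint sets $X,Y\subseteq V(G)$ form a TOI-coalition (are TOI-coalition partners) if neither $X$ nor $Y$ is a TOIDS of $G$ but $X\cup Y$ is a TOIDS of $G$. A TOI-coalition partition of $G$ is a partition $\Psi=\{V_1,\dots,V_k\}$ of $V(G)$ into nonempty sets such that for every $V_i\in\Psi$ there exists $V_j\in\Psi$, $j\ne i$, such that $V_i$ and $V_j$ form a TOI-coalition. The TOI-coalition number $C_t^{oi}(G)$ is the maximum cardinality of a TOI-coalition partition of $G$. *)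

(* Defs.v *)
From HB Require Import structures.
From mathcomp Require Import all_boot.

Set Implicit Arguments.
Unset Strict Implicit.
Unset Printing Implicit Defensive.

Record sgraph := SGraph {
  vertex :> finType;
  edge : rel vertex;
  edge_sym : symmetric edge;
  edge_irrefl : irreflexive edge }.

Section Defs.
Variable G : sgraph.
Implicit Types (D X Y : {set G}) (P : {set {set G}}).

Definition no_isolated := [forall v : G, exists u : G, edge v u].

Definition total_dominating D :=
  [forall v : G, exists u : G, (u \in D) && edge v u].

Definition independent D :=
  [forall u in D, forall v in D, ~~ edge u v].

Definition toids D := total_dominating D && independent (~: D).

(* A TOIDS exists as soon as there is no isolated vertex (toids_setT); only
   otherwise can the value be the junk one, #|G|. *)
Definition gamma_toi : nat := #|[arg min_(D < [set: G] | toids D) #|D| ]|.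

Definition toi_coalition X Y :=
  [&& X != set0, Y != set0, [disjoint X & Y],
      ~~ toids X, ~~ toids Y & toids (X :|: Y)].

(* [partition] already requires the parts to be nonempty. *)
Definition toi_coalition_partition P :=
  partition P [set: G] &&
  [forall X in P, exists Y in P, (Y != X) && toi_coalition X Y].

(* The empty maximum 0 does not interfere when there is no isolated vertex:
   the maximum is then over a nonempty set (toi_coalition_partition_exists). *)
Definition C_toi : nat :=
  \max_(P : {set {set G}} | toi_coalition_partition P) #|P|.

Lemma toids_setT : no_isolated -> toids [set: G].
Proof.
move=> /forallP niso; apply/andP; split.
  apply/forallP=> v; have /existsP[u vu] := niso v.
  by apply/existsP; exists u; rewrite inE.
by apply/forall_inP=> u; rewrite !inE.
Qed.

Lemma toids_gamma :
  no_isolated -> exists2 D, toids D & #|D| = gamma_toi.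
Proof.
move=> niso; rewrite /gamma_toi; case: arg_minnP; first exact: toids_setT.
by move=> D tD _; exists D.
Qed.

Lemma gamma_toi_min D : no_isolated -> toids D -> gamma_toi <= #|D|.
Proof.
move=> niso tD; rewrite /gamma_toi; case: arg_minnP; first exact: toids_setT.
by move=> E _; apply.
Qed.

Lemma toids_disjoint X Y :
  0 < #|G| -> toids X -> toids Y -> ~~ [disjoint X & Y].
Proof.
move=> /card_gt0P[v0 _] /andP[_ /forall_inP iX] /andP[/forallP dY _].
apply/negP=> dis.
have /existsP[u /andP[uY _]] := dY v0.
have /existsP[w /andP[wY uw]] := dY u.
have nX z : z \in Y -> z \in ~: X by move=> zY; rewrite inE (disjointFl dis zY).
by have /forall_inP/(_ w (nX w wY)) := iX u (nX u uY); rewrite uw.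
Qed.

Lemma toi_coalition_partition_exists :
  no_isolated -> exists P, toi_coalition_partition P.
Proof.
move=> niso; have [G0 | Gpos] := posnP #|G|.
  exists set0; apply/andP; split; last by apply/forall_inP=> X; rewrite inE.
  suff -> : [set: G] = set0 by rewrite partition_set0.
  by apply/eqP; rewrite -cards_eq0 cardsT G0.
have [E tE mE] := toids_gamma niso.
have [v0 _] := card_gt0P Gpos.
have /andP[/forallP/(_ v0)/existsP[x /andP[xE _]] _] := tE.
have ntx : ~~ toids [set x].
  apply/negP=> /andP[/forallP/(_ x)/existsP[u /andP[/set1P->]]].
  by rewrite edge_irrefl.
have x0 : [set x] != set0 by apply/set0Pn; exists x; rewrite set11.
have ntE : ~~ toids (E :\ x).
  apply/negP=> /(gamma_toi_min niso).
  by rewrite -mE (cardsD1 x E) xE ltnn.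
have E0 : E :\ x != set0.
  by apply: contraNneq ntx => e; rewrite -(setD1K xE) e setU0 in tE.
have pr X Y D : toi_coalition X Y -> D = X :|: Y -> partition [set X; Y] D.
  case/and4P=> X0 Y0 dXY _ ->; apply: partitionU1 => //.
  rewrite -[X in partition _ X](setU0 Y) -(setU0 [set Y]).
  by apply: partitionU1; rewrite ?partition_set0 // -setI_eq0 setI0.
have sym X Y : toi_coalition X Y -> toi_coalition Y X.
  case/and5P=> X0 Y0 d nX /andP[nY t].
  by rewrite /toi_coalition X0 Y0 disjoint_sym d nX nY setUC t.
have ne X Y : toi_coalition X Y -> X != Y.
  case/and3P=> X0 _ /andP[d _]; apply: contraNneq X0 => e.
  by move: d; rewrite -setI_eq0 -e setIid.
have coal X Y (P : {set {set G}}) : toi_coalition X Y -> Y \in P ->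
    [exists Z in P, (Z != X) && toi_coalition X Z].
  by move=> c YP; apply/exists_inP; exists Y; rewrite // eq_sym (ne _ _ c) c.
have [tC | ntC] := boolP (toids (~: [set x])); last first.
  have C0 : ~: [set x] != set0.
    by apply: contraNneq E0 => e; rewrite setDE e setI0.
  have c : toi_coalition [set x] (~: [set x]).
    rewrite /toi_coalition x0 C0 -setI_eq0 setICr eqxx ntx ntC setUCr.
    exact: toids_setT.
  exists [set [set x]; ~: [set x]]; apply/andP; split.
    by apply: pr => //; rewrite setUCr.
  apply/forall_inP=> Z /set2P[]->.
    by apply: coal c _; rewrite set22.
  by apply: coal (sym _ _ c) _; rewrite set21.
have eC : ~: E :|: E :\ x = ~: [set x].
  apply/setP=> z; rewrite !inE; case: eqVneq => [->|_]; first by rewrite xE.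
  by rewrite orNb.
have nX : ~~ toids (~: E).
  by apply/negP=> /(toids_disjoint Gpos tE); rewrite -setI_eq0 setICr eqxx.
have X0 : ~: E != set0.
  by apply: contraNneq ntE => e; rewrite -eC e set0U in tC.
have c1 : toi_coalition [set x] (E :\ x).
  by rewrite /toi_coalition x0 E0 disjoints1 !inE eqxx ntx ntE setD1K.
have c2 : toi_coalition (~: E) (E :\ x).
  rewrite /toi_coalition X0 E0 nX ntE eC tC !andbT -setI_eq0; apply/eqP/setP=> z.
  by rewrite !inE; case: (z \in E); rewrite ?andbF.
exists (~: E |: [set [set x]; E :\ x]); apply/andP; split.
  rewrite -(setUCr E) (setUC E); apply: partitionU1 => //.
    by apply: pr c1 _; rewrite setD1K.
  by rewrite -setI_eq0 setIC setICr.
apply/forall_inP=> Z /setU1P[->|/set2P[]->].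
- by apply: coal c2 _; rewrite !inE eqxx !orbT.
- by apply: coal c1 _; rewrite !inE eqxx !orbT.
- by apply: coal (sym _ _ c2) _; rewrite !inE eqxx.
Qed.

End Defs.

(* Main.v *)
Require Import Defs.
From mathcomp Require Import all_boot.

(** Take a coalition partition and two of its parts [X], [Y] that are partners.
    Their union is a TOIDS, so [X] and [Y] together use up at least
    [gamma_toi G] vertices; each of the other parts needs a vertex of its own
    among the at most [#|G| - gamma_toi G] remaining ones
    ([toi_coalition_partition_card]).  Equality holds for the complete graph on
    two vertices: its only TOIDS is the whole vertex set, so the bound is 2, and
    2 is reached because in a nonempty graph any coalition partition contains
    a pair of partners. *)

Lemma total_dominating_nbr (G : sgraph) (D : {set G}) (v : G) :
  total_dominating D -> exists2 u, u \in D & edge v u.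
Proof. by move=> /forallP/(_ v)/existsP[u /andP[]]; exists u. Qed.

Lemma toi_coalition_partition_partners (G : sgraph) (P : {set {set G}}) :
  toi_coalition_partition P -> P != set0 ->
  exists X Y, [/\ X \in P, Y \in P, Y != X & toi_coalition X Y].
Proof.
move=> /andP[_ /forall_inP partner] /set0Pn[X XP].
have /exists_inP[Y YP /andP[neYX cXY]] := partner X XP.
by exists X, Y.
Qed.

Lemma toi_coalition_partition_card (G : sgraph) (P : {set {set G}}) :
  no_isolated G -> toi_coalition_partition P ->
  #|P| <= #|G| - gamma_toi G + 2.
Proof.
move=> niso cP; have [-> | P0] := eqVneq P set0; first by rewrite cards0.
have [X [Y [XP YP neYX cXY]]] := toi_coalition_partition_partners _ _ cP P0.
have /andP[partP _] := cP; have /and3P[_ _ nP0] := partP.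
have /and5P[_ _ _ _ /andP[_ tXY]] := cXY.
have gammaXY : gamma_toi G <= #|X| + #|Y|.
  apply: leq_trans (gamma_toi_min niso tXY) _.
  by rewrite cardsU leq_subr.
have YPX : Y \in P :\ X by rewrite !inE neYX.
have cardG : #|G| = #|X| + (#|Y| + \sum_(A in P :\ X :\ Y) #|A|).
  by rewrite -cardsT (card_partition partP) (big_setD1 X) // (big_setD1 Y).
(* Each remaining part is nonempty, hence contributes at least 1. *)
have rest : #|P :\ X :\ Y| <= \sum_(A in P :\ X :\ Y) #|A|.
  rewrite -sum1_card; apply: leq_sum => A; rewrite !inE => /and3P[_ _ AP].
  by rewrite card_gt0; apply: contraNneq nP0 => <-.
rewrite (cardsD1 X) XP (cardsD1 Y) YPX addnA addnC leq_add2r.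
apply: leq_trans rest _.
rewrite cardG addnA -addnBAC //.
exact: leq_addl.
Qed.

Lemma C_toi_ge2 (G : sgraph) : no_isolated G -> 0 < #|G| -> 2 <= C_toi G.
Proof.
move=> niso Gpos; have [P cP] := toi_coalition_partition_exists niso.
apply: (@leq_trans #|P|); last exact: leq_bigmax_cond.
have P0 : P != set0.
  apply: contraTneq Gpos => P0; have /andP[partP _] := cP.
  by rewrite -cardsT (card_partition partP) P0 big_set0.
have [X [Y [XP YP neYX _]]] := toi_coalition_partition_partners _ _ cP P0.
by apply/card_gt1P; exists Y, X.
Qed.

Lemma neq_bool_sym : symmetric (fun a b : bool => a != b).
Proof. by move=> a b; rewrite eq_sym. Qed.

Lemma neq_bool_irrefl : irreflexive (fun a b : bool => a != b).
Proof. by move=> a; rewrite eqxx. Qed.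

Definition K2 : sgraph := SGraph neq_bool_sym neq_bool_irrefl.

Lemma no_isolated_K2 : no_isolated K2.
Proof. by apply/forallP=> v; apply/existsP; exists (~~ v); case: v. Qed.

(** Each vertex is the only neighbour of the other one, so total domination
    forces both into any TOIDS. *)
Lemma gamma_toi_K2 : gamma_toi K2 = 2.
Proof.
have [D /andP[tD _] <-] := toids_gamma no_isolated_K2.
rewrite -card_bool -cardsT; congr #|pred_of_set _|; apply/setP=> v; rewrite inE.
have [u uD] := total_dominating_nbr _ _ (~~ v : K2) tD.
by case: u v uD => [] [].
Qed.

Theorem proposition2 :
  (forall G : sgraph, no_isolated G -> C_toi G <= #|G| - gamma_toi G + 2) /\
  (exists G : sgraph, no_isolated G /\ C_toi G = #|G| - gamma_toi G + 2).
Proof.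
have bound G : no_isolated G -> C_toi G <= #|G| - gamma_toi G + 2.
  by move=> niso; apply/bigmax_leqP=> P; apply: toi_coalition_partition_card.
split=> //; exists K2; split; first exact: no_isolated_K2.
apply/eqP; rewrite eqn_leq bound ?no_isolated_K2 //=.
rewrite gamma_toi_K2 card_bool.
by apply: C_toi_ge2; rewrite ?no_isolated_K2 ?card_bool.
Qed.
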